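(* Let $p$ be an odd prime. If $\left(\frac{p}{7}\right)=-1$ and $p\not\equiv 15\pmod{16}$, then $$\left(\frac{D_p(1,16)}{p}\right)=\left(\frac{-2}{p}\right).$$
   Context: For an odd prime $q$, $\left(\frac{\cdot}{q}\right)$ denotes the Legendre symbol modulo $q$ (equal to $0$ on multiples of $q$). For an odd prime $p$ and $b,c\in\mathbb{Z}$, $D_p(b,c)$ denotes the integer determinant of the $(p-1)\times(p-1)$ matrix with $(i,j)$ entry $(i^2+bij+cj^2)^{p-2}$: $$D_p(b,c)=\left|(i^2+bij+cj^2)^{p-2}\right|_{1\le i,j\le p-1}.$$
   Formalization: The case p = 3 is excluded: it satisfies both conditions, but D_3(1,16) = -178, so its Legendre symbol modulo 3 is -1 while (-2/3) = 1, and the identity as stated fails there. *)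

(* Defs.v *)
From mathcomp Require Import all_boot all_order all_algebra.

Set Implicit Arguments.
Unset Strict Implicit.
Unset Printing Implicit Defensive.

Import Order.TTheory GRing.Theory Num.Theory.
Local Open Scope ring_scope.

(* Meaningful for q an odd prime only. *)
Definition legendre (a : int) (q : nat) : int :=
  if (q %| a)%Z then 0
  else if [exists x : 'I_q, ((x%:Z ^+ 2)%R == a %[mod q])%Z] then 1
  else -1.

(* Ordinals start at 0, hence the shifts i.+1 and j.+1. *)
Definition Ddet (p : nat) (b c : int) : int :=
  \det (\matrix_(i < p.-1, j < p.-1)
          (i.+1%:Z ^+ 2 + b * i.+1%:Z * j.+1%:Z + c * j.+1%:Z ^+ 2) ^+ (p - 2)).

Lemma Ddet3 : Ddet 3 1 16 = -178.
Proof.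
by rewrite /Ddet (expand_det_row _ ord0) !big_ord_recl big_ord0 /cofactor
  !det_mx11 !mxE.
Qed.

(* At p = 3, which divides the discriminant 1 - 4 * 16 = -63 of
   i^2 + i j + 16 j^2, the identity (D_p(1,16) / p) = (-2 / p) fails, although
   3 satisfies both congruence conditions of the theorem. *)
Lemma legendre_Ddet3 :
  [/\ legendre 3 7 = -1, 3 != 15 %[mod 16],
      legendre (Ddet 3 1 16) 3 = -1 & legendre (-2) 3 = 1].
Proof.
split=> //; rewrite ?Ddet3 /legendre /=.
- have -> // : [exists x : 'I_7, ((x%:Z ^+ 2)%R == 3 %[mod 7])%Z] = false.
  by apply/negbTE/existsPn; case; do 8?[case=> //].
- have -> // : [exists x : 'I_3, ((x%:Z ^+ 2)%R == -178 %[mod 3])%Z] = false.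
  by apply/negbTE/existsPn; case; do 4?[case=> //].
- have -> // : [exists x : 'I_3, ((x%:Z ^+ 2)%R == -2 %[mod 3])%Z].
  by apply/existsP; exists (Ordinal (isT : (1 < 3)%N)).
Qed.

(* Main.v *)
(* Work in an algebraic closure of F_p, and let u, v be the roots of
   X^2 + X + 16, exchanged by Frobenius.  Expanding the partial fractions of
   1 / ((i - u j) (i - v j)) into geometric sums factors the matrix as
   P diag(V_1, ..., V_(p-1)) Q E with V_n = u^n + v^n, P Q = -1 and E diagonal,
   so D_p(1,16) is a nonzero square of F_p times the product of the V_n.  As
   V_n = 16^(n-1) V_(p+1-n), this product is a square times V_1 V_((p+1)/2).

   Since (p/7) = -1, the Gauss periods a = w + w^2 + w^4, b = w^3 + w^5 + w^6 of
   a 7th root of unity w are conjugate, with a + b = -1 and a b = 2; moreover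
   u = - a^4, v = - b^4.  Hence V_1 V_((p+1)/2) = 8 (-1)^((p-1)/2), which is -2
   times a nonzero square of F_p in both cases modulo 4.  Finally V_n = 0 would
   say that u / v = (a / b)^4 has even order.  This order divides the odd part
   of p + 1 because a^(p+1) = b^(p+1) and, when p = 7 mod 8 (so that p + 1 is 8
   mod 16), a^((p+1)/2) = b^((p+1)/2) as 2 is a square modulo p. *)
Require Import Defs.
From mathcomp Require Import all_boot all_order all_algebra all_field.
From mathcomp Require Import ring zify.

Import Order.TTheory GRing.Theory Num.Theory.
Local Open Scope ring_scope.

(** * Frobenius, the prime field and the Legendre symbol *)

Lemma exprD_pchar (K : fieldType) (p : nat) (charK : p \in [pchar K])
    (x y : K) : (x + y) ^+ p = x ^+ p + y ^+ p.
Proof. by rewrite -!(pFrobenius_autE charK) rmorphD. Qed.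

Lemma exprN_pchar (K : fieldType) (p : nat) (charK : p \in [pchar K])
    (x : K) : (- x) ^+ p = - x ^+ p.
Proof. by rewrite -!(pFrobenius_autE charK) rmorphN. Qed.

Lemma intr_exp_pchar (K : fieldType) (p : nat) (charK : p \in [pchar K])
    (a : int) : a%:~R ^+ p = a%:~R :> K.
Proof. by rewrite -(pFrobenius_autE charK) rmorph_int. Qed.

Lemma natr_exp_pchar (K : fieldType) (p : nat) (charK : p \in [pchar K])
    (n : nat) : n%:R ^+ p = n%:R :> K.
Proof. by rewrite -(pFrobenius_autE charK) rmorph_nat. Qed.

Lemma natr_inj_pchar (K : fieldType) (p : nat) (charK : p \in [pchar K]) :
  {in gtn p &, injective (fun n : nat => n%:R : K)}.
Proof.
suff H m n : (m <= n)%N -> (n < p)%N -> m%:R = n%:R :> K -> m = n.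
  move=> m n; rewrite !inE => mp np e.
  by case: (leqP m n) => [/H|/ltnW /H] h; [|apply/esym]; apply: h.
move=> le_mn lt_np /eqP; rewrite eq_sym -subr_eq0 -natrB //.
rewrite -(dvdn_pcharf charK) => d; apply/eqP; rewrite eqn_leq le_mn /=.
case: (posnP (n - m)) => [/eqP|gt0]; first by rewrite subn_eq0.
by have := dvdn_leq gt0 d; lia.
Qed.

Lemma expr_predp_eq1 (K : fieldType) (p : nat) (x : K) :
  (0 < p)%N -> x ^+ p = x -> x != 0 -> x ^+ p.-1 = 1.
Proof.
move=> p_gt0 xp x0; apply: (mulfI x0).
by rewrite mulr1 -exprS prednK.
Qed.

(** ['X^p - 'X] has at most [p] roots, and the [p] images of the integers below [p] already fill
    them. *)
Lemma expr_fixedP (K : fieldType) (p : nat) (charK : p \in [pchar K]) (x : K) :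
  x ^+ p = x -> exists k : 'I_p, x = k%:R.
Proof.
move=> xp; have p_gt1 := prime_gt1 (pcharf_prime charK).
pose rs : seq K := [seq (i : nat)%:R | i <- iota 0 p].
have [/mapP[i] | xrs] := boolP (x \in rs).
  by rewrite mem_iota => lip ->; exists (Ordinal lip).
pose q : {poly K} := 'X^p - 'X.
have sq : size q = p.+1.
  by rewrite size_polyDl size_polyXn // size_polyN size_polyX.
have := @max_poly_roots _ q (x :: rs).
rewrite sq /= size_map size_iota ltnn; case/(_ _ _ _)/notF.
- by rewrite -size_poly_eq0 sq.
- rewrite /root !hornerE xp subrr eqxx; apply/allP=> _ /mapP[i _ ->].
  by rewrite /root !hornerE natr_exp_pchar // subrr.
- rewrite xrs map_inj_in_uniq ?iota_uniq // => i j.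
  by rewrite !mem_iota; apply: natr_inj_pchar.
Qed.

Lemma legendreE (K : fieldType) (p : nat) (charK : p \in [pchar K]) (a : int) :
  legendre a p = if a%:~R == 0 :> K then 0
    else if [exists x : 'I_p, x%:R ^+ 2 == a%:~R :> K] then 1 else -1.
Proof.
rewrite /legendre (dvdz_pcharf charK); case: ifP => // _.
congr (if _ then _ else _); apply: eq_existsb => x.
rewrite eqz_mod_dvd (dvdz_pcharf charK) rmorphB rmorphXn /= subr_eq0.
by rewrite -pmulrn.
Qed.

(** Being fixed by Frobenius, [t] lies in the prime field, so square roots modulo [p] pass from one
    side to the other on multiplying or dividing by [t]. *)
Lemma legendre_mul_sqr (K : fieldType) (p : nat) (charK : p \in [pchar K])
    (a b : int) (t : K) :
  t != 0 -> t ^+ p = t -> a%:~R = b%:~R * t ^+ 2 ->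
  legendre a p = legendre b p.
Proof.
move=> t0 tp eq_ab; rewrite !(legendreE _ _ charK) eq_ab.
rewrite mulf_eq0 expf_eq0 (negbTE t0) orbF; case: ifP => // _.
congr (if _ then _ else _); apply/existsP/existsP => -[x /eqP xE].
- have [|y yE] := expr_fixedP _ _ charK (x%:R / t).
    by rewrite expr_div_n tp natr_exp_pchar.
  by exists y; rewrite -yE expr_div_n xE mulfK // expf_neq0.
- have [|y yE] := expr_fixedP _ _ charK (x%:R * t).
    by rewrite exprMn tp natr_exp_pchar.
  by exists y; rewrite -yE exprMn xE.
Qed.

(** * Factorization of the determinant *)

(* Partial fractions of [1 / ((x - u y) (x - v y))], with [u], [v] conjugate:
   the geometric sums are computed from [x^(p-1) = 1] and [u^p = v]. *)
Lemma quadratic_geometric_sum (K : fieldType) (p : nat) (u v x y : K) :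
  (0 < p)%N -> u ^+ p = v -> v ^+ p = u -> x ^+ p.-1 = 1 -> y ^+ p.-1 = 1 ->
  (x - u * y) * (x - v * y) *
    (\sum_(m < p.-1) x ^+ (p.-1.-1 - m) * (u ^+ m.+1 + v ^+ m.+1) * y ^+ m.+1)
  = (u - v) ^+ 2 * y ^+ 2.
Proof.
move=> p_gt0 up vp x1 y1.
have geo (a b : K) : a ^+ p = b ->
    (x - a * y) * (\sum_(m < p.-1) x ^+ (p.-1.-1 - m) * a ^+ m.+1 * y ^+ m.+1)
    = (a - b) * y.
  move=> ab; have := subrXX x (a * y) p.-1.
  rewrite x1 exprMn y1 mulr1 => /(congr1 ( *%R (a * y))).
  rewrite mulrBr mulr1 mulrAC -exprS prednK // ab -mulrBl => ->.
  rewrite mulrCA; congr (_ * _); rewrite mulr_sumr.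
  by apply: eq_bigr => i _; rewrite exprMn !exprS; ring.
under eq_bigr do rewrite mulrDr mulrDl.
rewrite big_split /= mulrDr.
rewrite [X in X + _]mulrAC (geo _ _ up) -[X in _ + X]mulrA (geo _ _ vp).
by ring.
Qed.

Lemma Ddet_prod (K : fieldType) (p : nat) (charK : p \in [pchar K])
    (b c : int) (u v : K) :
  odd p -> u ^+ p = v -> v ^+ p = u -> u != v ->
  u + v = - b%:~R -> u * v = c%:~R ->
  exists t : K, [/\ t != 0, t ^+ p = t
    & (Ddet p b c)%:~R = t ^+ 2 * \prod_(m < p.-1) (u ^+ m.+1 + v ^+ m.+1)].
Proof.
move=> p_odd up vp neq_uv uDv uMv.
have p_pr := pcharf_prime charK; have p_gt0 := prime_gt0 p_pr.
have p_gt2 : (2 < p)%N by have := prime_gt1 p_pr; lia.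
pose x (i : 'I_p.-1) : K := i.+1%:R.
have xp i : x i ^+ p = x i by apply: natr_exp_pchar.
have x0 i : x i != 0.
  rewrite -(dvdn_pcharf charK); apply/negP=> /dvdn_leq -/(_ isT).
  by have := ltn_ord i; lia.
have x1 i : x i ^+ p.-1 = 1 by apply: expr_predp_eq1.
have x_inj : injective x.
  move=> i j /(natr_inj_pchar _ _ charK) E; apply: val_inj.
  apply: succn_inj; apply: E; rewrite inE.
    by have := ltn_ord i; lia.
  by have := ltn_ord j; lia.
pose D := (u - v) ^+ 2.
have D0 : D != 0 by rewrite expf_neq0 // subr_eq0.
have DE : D = (b ^+ 2 - 4 * c)%:~R.
  rewrite rmorphB rmorphXn rmorphM /= -uMv.
  have -> : b%:~R = - (u + v) by rewrite uDv opprK.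
  rewrite /D; ring.
have Dp : D ^+ p = D by rewrite DE intr_exp_pchar.
have D_def : (u - v) ^+ 2 = D by [].
clearbody D.
pose P := \matrix_(i < p.-1, m < p.-1) x i ^+ (p.-1.-1 - m).
pose V := \row_(m < p.-1) (u ^+ m.+1 + v ^+ m.+1).
pose Q := \matrix_(m < p.-1, j < p.-1) (x j ^+ m.+1).
pose E := \row_(j < p.-1) (D^-1 * x j ^- 2).
have detA : (Ddet p b c)%:~R = \det (P *m diag_mx V *m Q *m diag_mx E).
  rewrite /Ddet -(det_map_mx (intmul 1)); congr (\det _).
  apply/matrixP=> i j; rewrite !mul_mx_diag !mxE.
  under eq_bigr do rewrite !mxE.
  have := quadratic_geometric_sum _ _ _ _ _ _ p_gt0 up vp (x1 i) (x1 j).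
  set S := (X in _ * X = _ -> _); rewrite D_def => SE.
  rewrite rmorphXn !rmorphD !rmorphXn !rmorphM /= -!pmulrn -/(x i) -/(x j).
  set q := (_ + _ + _); have qE : q = (x i - u * x j) * (x i - v * x j).
    rewrite /q -uMv; have -> : b%:~R = - (u + v) by rewrite uDv opprK.
    ring.
  rewrite -qE in SE.
  have q0 : q != 0.
    apply/eqP=> q0; move/eqP: SE.
    by rewrite q0 mul0r eq_sym mulf_eq0 (negbTE D0) sqrf_eq0 (negbTE (x0 j)).
  have qp : q ^+ p = q.
    suff -> : q = (i.+1%:Z ^+ 2 + b * i.+1%:Z * j.+1%:Z + c * j.+1%:Z ^+ 2)%:~R.
      exact: intr_exp_pchar.
    by rewrite !rmorphD !rmorphXn !rmorphM.
  (* On nonzero elements of the prime field, the exponent [p - 2] is inversion. *)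
  have q1 : q * q ^+ (p - 2) = 1.
    rewrite -exprS (_ : (p - 2).+1 = p.-1); last by lia.
    exact: expr_predp_eq1.
  apply: (mulfI q0); rewrite q1 mulrA SE.
  by rewrite mulrACA (mulfV D0) mul1r mulfV ?expf_neq0.
(* Up to a factor [x j], an off-diagonal entry is the cofactor of [x i - x j] in
   [x i ^+ p.-1 - x j ^+ p.-1 = 0]; a diagonal entry is a sum of [p - 1] ones. *)
have PQ : P *m Q = (-1)%:M.
  apply/matrixP=> i j; rewrite !mxE.
  under eq_bigr do rewrite !mxE exprSr mulrA.
  rewrite -mulr_suml; have [<-{j} | ij] := eqVneq i j.
    have le_m (m : 'I_p.-1) : (m <= p.-1.-1)%N by have := ltn_ord m; lia.
    under eq_bigr => m _ do rewrite -exprD subnK //.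
    rewrite sumr_const card_ord mulrnAl -exprSr prednK; last by lia.
    by rewrite x1 -subn1 natrB // (pcharf0 charK) sub0r.
  have := subrXX (x i) (x j) p.-1.
  rewrite !x1 subrr => /esym/eqP; rewrite mulf_eq0 subr_eq0.
  by rewrite (inj_eq x_inj) (negbTE ij) /= => /eqP ->; rewrite mul0r.
pose r := p./2; have pE : p.-1 = r.*2.
  by rewrite /r; lia.
(* A square root of [\det (diag_mx E)], available because [p - 1] is even. *)
exists (D^-1 ^+ r * \prod_j (x j)^-1); split.
- rewrite mulf_neq0 ?expf_neq0 ?invr_neq0 //.
  by apply/prodf_neq0 => j _; rewrite invr_neq0.
- rewrite exprMn exprAC (exprVn D p) Dp -prodrXl.
  by congr (_ * _); apply: eq_bigr => j _; rewrite exprVn xp.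
rewrite detA !det_mulmx.
have -> : \det P * \det (diag_mx V) * \det Q = \det (P *m Q) * \det (diag_mx V).
  by rewrite det_mulmx mulrAC.
have sgn : (-1) ^+ p.-1 = 1 :> K by rewrite -signr_odd pE odd_double.
rewrite PQ det_scalar sgn mul1r !det_diag.
under eq_bigr do rewrite mxE.
rewrite mulrC; congr (_ * _).
under eq_bigr do rewrite mxE.
rewrite big_split /= prodr_const card_ord exprMn -(exprM _ r) muln2 -pE.
by congr (_ * _); rewrite -prodrXl; apply: eq_bigr => j _; rewrite exprVn.
Qed.

(** * The product of the [u ^+ n + v ^+ n] up to squares *)

(** The factors at [c - i] and [c + i] multiply to a square, so only the central factor survives. *)
Lemma prod_symmetric (R : comNzRingType) (f g : nat -> R) (c k : nat) :
  (k <= c)%N ->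
  (forall i, (0 < i <= k)%N -> f (c - i)%N = g i ^+ 2 * f (c + i)%N) ->
  \prod_(c - k <= n < (c + k).+1) f n =
    f c * (\prod_(1 <= i < k.+1) (g i * f (c + i)%N)) ^+ 2.
Proof.
elim: k => [|k IHk] le_kc fE.
  by rewrite subn0 addn0 big_nat1 big_geq // expr1n mulr1.
rewrite big_ltn; last by lia.
rewrite (_ : (c - k.+1).+1 = (c - k)%N); last by lia.
rewrite addnS big_nat_recr /=; last by lia.
rewrite IHk; [|lia|by move=> i hi; apply: fE; lia].
rewrite fE; last by lia.
by rewrite [in RHS]big_nat_recr //= addnS; ring.
Qed.

Lemma prod_conjugate_powers (K : fieldType) (p r : nat)
    (charK : p \in [pchar K]) (u v d : K) :
  p = r.*2.+1 -> u ^+ p = v -> v ^+ p = u -> u * v = d ^+ 2 -> d ^+ p = d ->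
  d != 0 -> (forall n, u ^+ n + v ^+ n != 0) ->
  exists t : K, [/\ t != 0, t ^+ p = t
    & \prod_(m < p.-1) (u ^+ m.+1 + v ^+ m.+1) =
      t ^+ 2 * ((u + v) * (u ^+ r.+1 + v ^+ r.+1))].
Proof.
move=> pE up vp uMv dp d0 V0; pose V n := u ^+ n + v ^+ n.
have Vp n : V n ^+ p = V n.
  by rewrite exprD_pchar // exprAC up exprAC vp addrC.
have r_gt0 : (0 < r)%N by have := prime_gt1 (pcharf_prime charK); lia.
(* Reflection [n -> p + 1 - n], centred at [r.+1]: multiply [V (r.+1 + i)] by [(u * v) ^+ (r - i)]
   and reduce with [u ^+ p = v], [v ^+ p = u]. *)
have V_sym i : (0 < i <= r.-1)%N ->
    V (r.+1 - i)%N = (d ^+ (r - i)) ^+ 2 * V (r.+1 + i)%N.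
  move=> hi; rewrite exprAC -uMv exprMn /V.
  transitivity (v ^+ (r - i) * u ^+ (r - i + (r.+1 + i)) +
                u ^+ (r - i) * v ^+ (r - i + (r.+1 + i))).
    rewrite (_ : r - i + (r.+1 + i) = p)%N; last by lia.
    by rewrite up vp -!exprSr addrC subSn //; lia.
  by rewrite !exprD; ring.
exists (\prod_(1 <= i < r.-1.+1) (d ^+ (r - i) * V (r.+1 + i)%N)); split.
- by rewrite prodf_seq_neq0; apply/allP => i _; rewrite mulf_neq0 ?expf_neq0 ?V0.
- rewrite -prodrXl; apply: eq_bigr => i _.
  by rewrite exprMn exprAC dp Vp.
rewrite -(big_mkord xpredT (fun m => V m.+1)) -(big_add1 _ _ 0 _ xpredT V).
(* The mirror image of [n = 1] is [n = p], outside the product, so [V 1] is split off. *)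
rewrite big_ltn; last by lia.
have := @prod_symmetric _ V (fun i => d ^+ (r - i)) r.+1 r.-1 _ V_sym.
rewrite (_ : r.+1 - r.-1 = 2)%N; last by lia.
rewrite (_ : (r.+1 + r.-1).+1 = p)%N; last by lia.
by move=> ->; [rewrite /V !expr1; ring | lia].
Qed.

(** Raising [u ^+ n = - v ^+ n] to the odd power [N] would make a power of [v] equal to its own
    opposite. *)
Lemma add_expr_neq0 (K : fieldType) (u v : K) (N n : nat) :
  (2 : K) != 0 -> v != 0 -> odd N -> u ^+ N = v ^+ N -> u ^+ n + v ^+ n != 0.
Proof.
move=> two0 v0 N_odd eqN; rewrite addr_eq0; apply/eqP=> eqn.
have : (u ^+ N) ^+ n = - (v ^+ N) ^+ n.
  by rewrite exprAC eqn exprNn -signr_odd N_odd expr1 mulN1r exprAC.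
move/eqP; rewrite eqN -addr_eq0 -mulr2n -mulr_natl mulf_eq0 (negbTE two0).
by rewrite !expf_eq0 (negbTE v0) !andbF.
Qed.

(** * Gauss periods modulo 7 and the square root of 2 *)

(** The exponents 1, 2, 4 are the nonzero squares modulo 7 and 3, 5, 6 the nonsquares;
    multiplication by a nonsquare [p] swaps the two classes. *)
Lemma cyclotomic7 (K : fieldType) (p : nat) (charK : p \in [pchar K]) (w : K) :
  \sum_(i < 7) w ^+ i = 0 -> (p %% 7)%N \in [:: 3; 5; 6] ->
  exists a b : K, [/\ a + b = -1, a * b = 2, a ^+ p = b & b ^+ p = a].
Proof.
move=> w_root p7.
pose a := w + w ^+ 2 + w ^+ 4; pose b := w ^+ 3 + w ^+ 5 + w ^+ 6.
have w6 : w ^+ 6 = - (1 + w + w ^+ 2 + w ^+ 3 + w ^+ 4 + w ^+ 5).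
  apply/eqP; rewrite -addr_eq0 -w_root !big_ord_recl big_ord0 /=.
  by apply/eqP; ring.
have w7 : w ^+ 7 = 1 by rewrite exprS w6; ring: w6.
have expw n : w ^+ n = w ^+ (n %% 7).
  by rewrite {1}(divn_eq n 7) exprD mulnC exprM w7 expr1n mul1r.
have wp := expw p; exists a, b; split.
- by rewrite /a /b w6; ring.
- by rewrite /a /b; ring: w6.
- rewrite /a !exprD_pchar // (exprAC w 2 p) (exprAC w 4 p) wp; move: p7; rewrite !inE.
  by move=> /or3P[] /eqP->; rewrite -!exprM
    [w ^+ (_ * 2)]expw [w ^+ (_ * 4)]expw /= /b; ring.
- rewrite /b !exprD_pchar // (exprAC w 3 p) (exprAC w 5 p) (exprAC w 6 p) wp.
  move: p7; rewrite !inE.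
  by move=> /or3P[] /eqP->; rewrite -!exprM
    [w ^+ (_ * 3)]expw [w ^+ (_ * 5)]expw [w ^+ (_ * 6)]expw /= /a; ring.
Qed.

Lemma two_expr_half (K : fieldType) (p : nat) (charK : p \in [pchar K]) (z : K) :
  odd p -> z ^+ 4 = -1 -> (p %% 8 = 7)%N -> 2 ^+ p.-1./2 = 1 :> K.
Proof.
move=> p_odd z4 p8; (* [z - z^3 = z + z^-1] is a square root of 2, fixed by Frobenius. *)
pose s := z - z ^+ 3.
have s2 : s ^+ 2 = 2 by rewrite /s; ring: z4.
have z8 : z ^+ 8 = 1 by ring: z4.
have zp : z ^+ p = - z ^+ 3.
  rewrite (divn_eq p 8) p8 exprD mulnC exprM z8 expr1n mul1r; ring: z4.
have sp : s ^+ p = s.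
  by rewrite /s exprD_pchar // exprN_pchar // exprAC zp; ring: z4.
have s0 : s != 0.
  apply/eqP=> s0; have /eqP := s2; rewrite s0 expr0n eq_sym /=.
  rewrite -(dvdn_pcharf charK) => /dvdn_leq -/(_ isT); lia.
rewrite -s2 -exprM mul2n (_ : p.-1./2.*2 = p.-1); last by lia.
by apply: expr_predp_eq1 => //; lia.
Qed.

(** * The case [b = 1], [c = 16] *)

Lemma nonresidue7 (p : nat) : legendre p%:Z 7 = -1 -> (p %% 7)%N \in [:: 3; 5; 6].
Proof.
rewrite /legendre; case: ifP => // p7; case: ifP => // /existsPn sq _.
have {}sq k : (k < 7)%N -> (k ^ 2 != p %[mod 7])%N.
  move=> k7; have := sq (Ordinal k7).
  by rewrite expr2 -PoszM !modz_nat.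
have := sq 1%N isT; have := sq 3%N isT; have := sq 2%N isT; have := sq 0%N isT.
rewrite !inE; have := ltn_pmod p (isT : (0 < 7)%N).
by case: (p %% 7)%N => [|[|[|[|[|[|[|]]]]]]].
Qed.

Lemma pchar_closed_field (p : nat) :
  prime p -> exists K : closedFieldType, p \in [pchar K].
Proof.
move=> p_pr; have [K [f _]] := countable_algebraic_closure 'F_p.
by exists K; apply: (rmorph_pchar f); apply: pchar_Fp.
Qed.

Theorem theorem1p3 (p : nat) (p_prime : prime p) (p_odd : odd p)
    (p_neq3 : p <> 3%N)
    (hp7 : legendre p%:Z 7 = -1) (hp16 : (p <> 15 %[mod 16])%N) :
  legendre (Ddet p 1 16) p = legendre (-2) p.
Proof.
have [K charK] := pchar_closed_field _ p_prime.
have p7 := nonresidue7 _ hp7.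
have prime_neq0 n : prime n -> (n == p) = false -> n%:R != 0 :> K.
  by move=> n_pr np; rewrite -(dvdn_pcharf charK) dvdn_prime2 // eq_sym np.
have two0 : 2 != 0 :> K by apply: prime_neq0 => //; apply/eqP; lia.
have three0 : 3 != 0 :> K by apply: prime_neq0 => //; apply/eqP; lia.
have seven0 : 7 != 0 :> K.
  by apply: prime_neq0 => //; apply/eqP=> p_eq7; rewrite -p_eq7 in p7.
have [w w_root] : exists w : K, \sum_(i < 7) w ^+ i = 0.
  have /closed_rootP[w] : size (\poly_(i < 7) (1 : K)) != 1.
    by rewrite size_poly_eq // oner_eq0.
  rewrite /root horner_poly => /eqP w_root; exists w; rewrite -[RHS]w_root.
  by apply: eq_bigr => i _; rewrite mul1r.
have [z z4] : exists z : K, z ^+ 4 = -1.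
  have /closed_rootP[z] : size ('X^4 + 1%:P : {poly K}) != 1.
    by rewrite size_XnaddC.
  by rewrite /root !hornerE addr_eq0 => /eqP z4; exists z.
have [a [b [aDb aMb ap bp]]] := cyclotomic7 _ _ charK _ w_root p7.
have b0 : b != 0.
  by have := two0; rewrite -aMb mulf_eq0 negb_or => /andP[].
have [r pE] : exists r, p = r.*2.+1 by exists p./2; clear - p_odd; lia.
have ap1 : a ^+ p.+1 = 2 by rewrite exprS ap.
have bp1 : b ^+ p.+1 = 2 by rewrite exprS bp mulrC.
have ab_half : (p %% 8 = 7)%N -> a ^+ r.+1 = b ^+ r.+1.
  move=> p8; rewrite -ap -exprM.
  have -> : (p * r.+1 = r.+1 + p.+1 * r)%N by clear - pE; lia.
  rewrite exprD exprM ap1 (_ : r = p.-1./2); last by clear - pE; lia.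
  by rewrite (two_expr_half _ _ charK z) // mulr1.
(* [N] is the odd part of [p + 1]: [(p + 1) / 2], [(p + 1) / 4] or [(p + 1) / 8], since [r = 7]
   modulo 8 would mean [p = 15] modulo 16. *)
have [N N_odd eqN] : exists2 N, odd N & (a ^+ 4) ^+ N = (b ^+ 4) ^+ N.
  have [r_odd|r_even] := boolP (odd r); last first.
    exists r.+1 => //; rewrite -!exprM.
    have -> : (4 * r.+1 = p.+1 * 2)%N by clear - pE; lia.
    by rewrite !exprM ap1 bp1.
  have [r1|r3] : (r %% 4 = 1 \/ r %% 8 = 3)%N by clear - pE r_odd hp16; lia.
    exists r.+1./2; first by clear - r1; lia.
    rewrite -!exprM (_ : 4 * r.+1./2 = p.+1)%N; last by clear - pE r1; lia.
    by rewrite ap1 bp1.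
  (* Now [4 * N] is only half of [p + 1], which is why [ab_half] is needed. *)
  exists (r.+1 %/ 4)%N; first by clear - r3; lia.
  rewrite -!exprM (_ : 4 * (r.+1 %/ 4) = r.+1)%N; last by clear - r3; lia.
  by apply: ab_half; clear - pE r3; lia.
pose u := - a ^+ 4; pose v := - b ^+ 4.
have bE : b = -1 - a by rewrite -aDb; ring.
have a2 : a ^+ 2 = - a - 2 by rewrite -aMb bE; ring.
have uDv : u + v = -1 by rewrite /u /v bE; ring: a2.
have uMv : u * v = 4 ^+ 2 by rewrite /u /v mulrNN -exprMn aMb; ring.
have up : u ^+ p = v by rewrite exprN_pchar // exprAC ap.
have vp : v ^+ p = u by rewrite exprN_pchar // exprAC bp.
have neq_uv : u != v.
  (* The discriminant -63 is nonzero because [p] is neither 3 nor 7. *)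
  have uBv : (u - v) ^+ 2 = - (3 * 3 * 7).
    transitivity ((u + v) ^+ 2 - 4 * (u * v)); first by ring.
    by rewrite uDv uMv; ring.
  rewrite -subr_eq0 -sqrf_eq0 uBv oppr_eq0.
  by rewrite !mulf_neq0.
have four0 : 4 != 0 :> K by rewrite (_ : 4 = 2 * 2) ?mulf_neq0 //; ring.
have v0 : v != 0 by rewrite oppr_eq0 expf_neq0.
have V0 n : u ^+ n + v ^+ n != 0.
  apply: (add_expr_neq0 _ _ _ N) => //.
  by rewrite /u /v [LHS]exprNn [RHS]exprNn eqN.
have [s [s0 sp sE]] := prod_conjugate_powers _ _ _ charK _ _ _ pE up vp uMv
  (natr_exp_pchar _ _ charK 4) four0 V0.
have uDv' : u + v = - 1%:~R by rewrite uDv.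
have uMv' : u * v = 16%:~R by rewrite uMv; ring.
have [t [t0 tp DE]] := Ddet_prod _ _ charK 1 16 _ _ p_odd up vp neq_uv uDv' uMv'.
have mid : u ^+ r.+1 + v ^+ r.+1 = (-1) ^+ r.+1 * 8.
  rewrite /u /v !(exprNn (_ ^+ 4)) -mulrDr -!exprM.
  have -> : (4 * r.+1 = p.+1 * 2)%N by clear - pE; lia.
  by rewrite !exprM ap1 bp1; congr (_ * _); ring.
(* For even [r], [p = 1] modulo 4 and [z ^+ 2] is a square root of -1 in the prime field. *)
have [i [i0 ip i2]] : exists i : K, [/\ i != 0, i ^+ p = i & i ^+ 2 = (-1) ^+ r.+1].
  have [r_odd|r_even] := boolP (odd r).
    by exists 1; split; rewrite ?oner_eq0 ?expr1n // -signr_odd /= r_odd.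
  exists (z ^+ 2); split.
  - apply/eqP=> z0; have /eqP := z4.
    by rewrite (exprM z 2 2) z0 expr0n eq_sym oppr_eq0 oner_eq0.
  - rewrite -exprM (_ : 2 * p = 4 * r + 2)%N; last by clear - pE; lia.
    by rewrite exprD exprM z4 -signr_odd (negbTE r_even) mul1r.
  - by rewrite -exprM z4 -signr_odd /= r_even.
(* The determinant is [s ^+ 2 * t ^+ 2 * (-1) * (i ^+ 2 * 8)], and [-8 = -2 * 2 ^+ 2]. *)
apply: (legendre_mul_sqr _ _ charK _ _ (2 * i * s * t)).
- by rewrite !mulf_neq0.
- by rewrite !exprMn ip sp tp natr_exp_pchar.
- rewrite DE sE uDv mid -i2; ring.
Qed.
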